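(* Invariants of degree at most $3$ are not sufficient to separate all the orbits in the regular representation of the symmetric group $\mathrm{S}_3$ over the field of rational numbers; that is, for $V=\mathcal{F}(\mathrm{S}_3,\mathbb{Q})$ there exist $v,w\in V$ with $\mathrm{S}_3\cdot v\neq\mathrm{S}_3\cdot w$ such that $f(v)=f(w)$ for all $f\in\mathbb{Q}[V]^{\mathrm{S}_3}$ of degree at most $3$. Moreover, we have $$\beta_{\mathrm{sep}}^{\mathbb{Q}}(\mathrm{S}_3)=4.$$
   Context: For a finite group $G$ and a field $\mathbb{F}$, the regular representation $\mathcal{F}(G,\mathbb{F})$ is the space of functions $G\to\mathbb{F}$ with $G$-action $(g\cdot f)(h)=f(g^{-1}h)$. For a finite dimensional representation $V$ of $G$ over $\mathbb{F}$, $\mathbb{F}[V]$ is the coordinate ring (polynomial algebra in the coordinate functions on $V$, with standard grading), with $G$-action $(g\cdot f)(v)=f(g^{-1}v)$, and $\mathbb{F}[V]^G$ is the subalgebra of polynomial invariants. $\beta_{\mathrm{sep}}(G,V)$ is the minimal positive integer $d$ such that for any $v,w\in V$ with $G\cdot v\neq G\cdot w$ there exists an $f\in\mathbb{F}[V]^G$ of degree at most $d$ with $f(v)\neq f(w)$. $\beta_{\mathrm{sep}}^{\mathbb{F}}(G)$ is the maximum of $\beta_{\mathrm{sep}}(G,V)$ as $V$ ranges over all finite dimensional representations of $G$ over $\mathbb{F}$. *)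

(* Defs.v *)
From HB Require Import structures.
From mathcomp Require Import all_boot all_order all_algebra all_fingroup.
From mathcomp Require Export mpoly.

Set Implicit Arguments.
Unset Strict Implicit.
Unset Printing Implicit Defensive.

Import GRing.Theory.
Local Open Scope ring_scope.

Record fdrep (gT : finGroupType) (F : fieldType) := FdRep {
  rep_space :> vectType F;
  rep_act : gT -> rep_space -> rep_space;
  rep_linear : forall g, linear (rep_act g);
  rep_act1 : forall v, rep_act 1%g v = v;
  rep_actM : forall g h v, rep_act (g * h)%g v = rep_act g (rep_act h v) }.

Section Representation.
Variables (gT : finGroupType) (F : fieldType) (V : fdrep gT F).

Definition rep_orbit (v : V) : {pred V} :=
  [pred u | [exists g : gT, u == rep_act g v]].

Definition crd (i : 'I_(\dim {:V})) (v : V) : F := coord (vbasis {:V}) i v.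

(* The coordinate ring: 'X_i stands for the coordinate function crd i.  Formal
   polynomials are needed, since F may be finite. *)
Definition coord_ring := {mpoly F[\dim {:V}]}.

Definition peval (f : coord_ring) (v : V) : F := f.@[fun i => crd i v].

(* The linear form v |-> crd i (g^-1 v), expanded in the coordinates of v. *)
Definition act_coord (g : gT) (i : 'I_(\dim {:V})) : coord_ring :=
  \sum_j crd i (rep_act g^-1%g (tnth (vbasis {:V}) j)) *: 'X_j.

Definition poly_act (g : gT) (f : coord_ring) : coord_ring :=
  f \mPo [tuple act_coord g i | i < \dim {:V}].

Lemma peval_act g f v : peval (poly_act g f) v = peval f (rep_act g^-1%g v).
Proof.
rewrite /peval /poly_act comp_mpoly_meval; apply: meval_eq => i.
rewrite tnth_mktuple /act_coord raddf_sum /=.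
pose rg := HB.pack_for {linear V -> V} (rep_act g^-1%g)
  (GRing.isLinear.Build _ _ _ _ _ (@rep_linear gT F V g^-1%g)).
have -> : rep_act g^-1%g v = rg v by [].
rewrite {2}(coord_vbasis (memvf v)) linear_sum /crd linear_sum.
by apply: eq_bigr => j _; rewrite mevalZ mevalXU !linearZ mulrC -tnth_nth.
Qed.

Definition poly_invariant (f : coord_ring) := forall g : gT, poly_act g f = f.

(* "degree at most d" is msize f <= d.+1, as msize is the degree plus one. *)
Definition separates_orbits (d : nat) :=
  forall v w : V, ~ (rep_orbit v =i rep_orbit w) ->
  exists f : coord_ring,
    [/\ poly_invariant f, (msize f <= d.+1)%N & peval f v <> peval f w].

Definition is_beta_sep (d : nat) :=
  [/\ (0 < d)%N, separates_orbits d
    & forall e, (0 < e)%N -> separates_orbits e -> (d <= e)%N].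

End Representation.

(* d is the maximum of the numbers beta_sep(G, V); the second conjunct also
   asserts that each of these numbers exists. *)
Definition is_beta_sep_field (gT : finGroupType) (F : fieldType) (d : nat) :=
  (exists V : fdrep gT F, is_beta_sep V d) /\
  (forall V : fdrep gT F, exists2 e, is_beta_sep V e & (e <= d)%N).

Lemma is_beta_sep_uniq gT F (V : fdrep gT F) d e :
  is_beta_sep V d -> is_beta_sep V e -> d = e.
Proof.
case=> d_gt0 sd dmin [e_gt0 se emin].
by apply/eqP; rewrite eqn_leq dmin // emin.
Qed.

Section Regular.
Variables (gT : finGroupType) (F : fieldType).

Definition reg_act (g : gT) (f : {ffun gT -> F^o}) : {ffun gT -> F^o} :=
  [ffun h => f (g^-1 * h)%g].

Fact reg_act_linear g : linear (reg_act g).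
Proof. by move=> a u v; apply/ffunP=> h; rewrite !ffunE. Qed.

Fact reg_act1 f : reg_act 1%g f = f.
Proof. by apply/ffunP=> h; rewrite ffunE invg1 mul1g. Qed.

Fact reg_actM g h f : reg_act (g * h)%g f = reg_act g (reg_act h f).
Proof. by apply/ffunP=> x; rewrite !ffunE invMg mulgA. Qed.

Definition regular_rep : fdrep gT F :=
  FdRep reg_act_linear reg_act1 reg_actM.

End Regular.

(* Main.v *)
(* Upper bound.  For v in V put B_i(v) = sum of the g v with g 0 = i, and
   S(v) = sum of the sgn(g) g v.  A permutation h acts by B_i(h v) = B_(h i)(v)
   and S(h v) = sgn(h) S(v), and these vectors determine v.  Apply a linear form
   l that does not kill any of the finitely many nonzero vectors in play.  The
   cubic invariants prod_i (l(B_i) - t) determine the multiset of the l(B_i), so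
   two points v, w that agree on invariants of degree at most 4 may be assumed to
   have the same B_i.  The invariant l(S)^2 gives S(w) = S(v) or S(w) = - S(v).
   In the second case, with S(v) <> 0, the quartic l(S) prod_(i<j) (l(B_j) -
   l(B_i)) forces B_i(v) = B_j(v) for some i <> j, and then the transposition
   (i j) maps v to w.

   Lower bound.  In the regular representation take v = sgn + a and w = - sgn + a,
   where a(h) = h^-1 0 lies in a single copy of the permutation representation
   and has three distinct values.  Averaging over the group, it suffices to
   compare the orbit sums of products of at most three linear forms; these differ
   by multiples of the sums of sgn(g) phi(g i) phi(g j), which vanish. *)
From HB Require Import structures.
Require Import Defs.
From mathcomp Require Import all_boot all_order all_algebra all_fingroup.
From mathcomp Require Import ring lra.
From Stdlib Require Import Classical.

Set Implicit Arguments.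
Unset Strict Implicit.
Unset Printing Implicit Defensive.

Import GRing.Theory Num.Theory.
Local Open Scope ring_scope.

(** * Degree bounds for sums, products and powers of polynomials *)

Section PolyDegree.
Variables (n : nat) (F : fieldType).
Implicit Types p q : {mpoly F[n]}.

Lemma msizeM_leq p q a b :
  (msize p <= a.+1)%N -> (msize q <= b.+1)%N -> (msize (p * q) <= (a + b).+1)%N.
Proof.
have [->|p0] := eqVneq p 0; first by rewrite mul0r msize0.
have [->|q0] := eqVneq q 0; first by rewrite mulr0 msize0.
move=> pa qb; rewrite msizeM //.
by rewrite -subn1 leq_subLR add1n -addnS -addSn leq_add.
Qed.

Lemma msize_prod_leq (I : Type) (r : seq I) (P : pred I) (f : I -> {mpoly F[n]})
    (d : I -> nat) :
  (forall i, P i -> msize (f i) <= (d i).+1)%N ->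
  (msize (\prod_(i <- r | P i) f i) <= (\sum_(i <- r | P i) d i).+1)%N.
Proof.
move=> fd; apply: (big_ind2 (fun p k => msize p <= k.+1)%N) => //.
  by rewrite msize1.
by move=> p a q b; apply: msizeM_leq.
Qed.

Lemma msizeX_leq p a k : (msize p <= a.+1)%N -> (msize (p ^+ k) <= (a * k).+1)%N.
Proof.
move=> pa; elim: k => [|k IHk]; first by rewrite expr0 msize1.
by rewrite exprS mulnS msizeM_leq.
Qed.

Lemma msize_sum_leq (I : Type) (r : seq I) (P : pred I) (f : I -> {mpoly F[n]}) d :
  (forall i, P i -> msize (f i) <= d)%N ->
  (msize (\sum_(i <- r | P i) f i) <= d)%N.
Proof.
move=> fd; apply: (big_ind (fun p => msize p <= d)%N) => //.
  by rewrite msize0.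
by move=> p q pd qd; rewrite (leq_trans (msizeD_le _ _)) // geq_max pd.
Qed.

Lemma msizeB_leq p q d :
  (msize p <= d)%N -> (msize q <= d)%N -> (msize (p - q) <= d)%N.
Proof.
by move=> pd qd; rewrite (leq_trans (msizeD_le _ _)) // geq_max pd msizeN.
Qed.

End PolyDegree.

(** * The induced action on polynomials, and linear forms *)

Section PolyAction.
Variables (gT : finGroupType) (F : fieldType) (V : fdrep gT F).
Implicit Types (f : coord_ring V) (g h : gT) (u v w : V).

HB.instance Definition _ g :=
  GRing.isLinear.Build F V V *:%R (@rep_act gT F V g) (@rep_linear gT F V g).

HB.instance Definition _ g := GRing.LRMorphism.copy
  (@poly_act gT F V g) (comp_mpoly [tuple act_coord g i | i < \dim {:V}]).

Lemma rep_orbitP u v : reflect (exists g, u = rep_act g v) (u \in rep_orbit v).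
Proof. exact: 'exists_eqP. Qed.

Lemma rep_orbit_act g v : rep_orbit (rep_act g v) =i rep_orbit v.
Proof.
move=> u; apply/rep_orbitP/rep_orbitP => -[h ->].
  by exists (h * g)%g; rewrite rep_actM.
by exists (h * g^-1)%g; rewrite -rep_actM mulgKV.
Qed.

Lemma poly_actX g (i : 'I_(\dim {:V})) : poly_act g 'X_i = act_coord g i.
Proof. by rewrite /poly_act comp_mpolyXU -tnth_nth tnth_mktuple. Qed.

(** On coefficients this is the product of the matrices of [h^-1] and [g^-1]. The identity is one of
    formal polynomials, not only of their values. *)
Lemma poly_act_coord g h (i : 'I_(\dim {:V})) :
  poly_act g (act_coord h i) = act_coord (g * h)%g i.
Proof.
rewrite /act_coord raddf_sum /=.
under eq_bigr => j _ do rewrite linearZ /= poly_actX /act_coord scaler_sumr.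
rewrite exchange_big /=; apply: eq_bigr => k _.
under eq_bigr => j _ do rewrite scalerA.
rewrite -scaler_suml; congr (_ *: _).
rewrite invMg rep_actM [in RHS](coord_vbasis (memvf (rep_act g^-1 _))).
rewrite linear_sum /crd linear_sum; apply: eq_bigr => j _.
by rewrite !linearZ -tnth_nth mulrC.
Qed.

Lemma poly_actM g h (f : coord_ring V) :
  poly_act g (poly_act h f) = poly_act (g * h)%g f.
Proof.
rewrite {2 3}/poly_act !comp_mpolyEX raddf_sum /=; apply: eq_bigr => m _.
rewrite linearZ /= !comp_mpolyX rmorph_prod; congr (_ *: _).
by apply: eq_bigr => i _; rewrite rmorphXn /= !tnth_mktuple poly_act_coord.
Qed.

(** Each variable is replaced by a linear form, so no monomial gains degree. *)
Lemma msize_poly_act g (f : coord_ring V) : (msize (poly_act g f) <= msize f)%N.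
Proof.
rewrite /poly_act comp_mpolyEX big_seq; apply: msize_sum_leq => m mf.
rewrite (leq_trans (msizeZ_le _ _)) // (leq_trans _ (msize_mdeg_lt mf)) //.
rewrite comp_mpolyX mdegE; apply: msize_prod_leq => i _.
rewrite (leq_trans (msizeX_leq (a := 1) _ _)) ?mul1n // tnth_mktuple.
apply: msize_sum_leq => j _; rewrite (leq_trans (msizeZ_le _ _)) //.
by rewrite msizeX mdeg1.
Qed.

Lemma peval_actV g (f : coord_ring V) v :
  peval (poly_act g^-1%g f) v = peval f (rep_act g v).
Proof. by rewrite peval_act invgK. Qed.

Lemma poly_invariant_peval (f : coord_ring V) g v :
  poly_invariant f -> peval f (rep_act g v) = peval f v.
Proof. by move=> fG; rewrite -{2}(fG g^-1%g) peval_actV. Qed.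

Lemma pevalM (f1 f2 : coord_ring V) v :
  peval (f1 * f2) v = peval f1 v * peval f2 v.
Proof. exact: rmorphM. Qed.

Definition lform (c : 'I_(\dim {:V}) -> F) : coord_ring V := \sum_j c j *: 'X_j.

Lemma peval_lform c v : peval (lform c) v = \sum_j c j * crd j v.
Proof.
rewrite /peval raddf_sum; apply: eq_bigr => j _.
by rewrite /= mevalZ mevalXU.
Qed.

Lemma peval_lform_is_linear c : linear (peval (lform c) : V -> F^o).
Proof.
move=> a u v; rewrite !peval_lform scaler_sumr -big_split; apply: eq_bigr => j _.
by rewrite /= /crd linearP /= mulrDr mulrCA.
Qed.

HB.instance Definition _ c := GRing.isLinear.Build F V F^o *:%R
  (peval (lform c)) (peval_lform_is_linear c).

Lemma msize_lform c : (msize (lform c) <= 2)%N.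
Proof.
apply: msize_sum_leq => j _; rewrite (leq_trans (msizeZ_le _ _)) //.
by rewrite msizeX mdeg1.
Qed.

Lemma crd_eq0 v : (forall i, crd i v = 0) -> v = 0.
Proof.
move=> v0; rewrite (coord_vbasis (memvf v)) big1 // => i _.
by rewrite -/(crd i v) v0 scale0r.
Qed.

End PolyAction.

(** * Linear forms that kill no nonzero vector of a finite list *)

Lemma exists_nonroot (F : numDomainType) (p : {poly F}) :
  p != 0 -> exists t, p.[t] != 0.
Proof.
(* In characteristic 0 these are [size p] distinct points, more than [p] has roots. *)
move=> p0; pose s := mkseq (fun i => i%:R : F) (size p).
have [/allP s0|/allPn[t _]] := boolP (all (root p) s); last by exists t.
have: (size s < size p)%N.
  apply: max_poly_roots => //; first exact/allP.
  by rewrite mkseq_uniq // => i j /eqP; rewrite eqr_nat => /eqP.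
by rewrite size_mkseq ltnn.
Qed.

(* On the curve of forms with coefficients (1, t, t^2, ..), each nonzero vector
   is killed only by the finitely many roots t of one nonzero polynomial. *)
Lemma exists_lform_neq0 (gT : finGroupType) (F : numFieldType) (V : fdrep gT F)
    (D : seq V) :
  exists c, {in D, forall d, peval (lform c) d = 0 -> d = 0}.
Proof.
pose P (d : V) : {poly F} := \sum_(j < \dim {:V}) crd j d *: 'X^j.
have P0 d : d != 0 -> P d != 0.
  apply: contra_neq => Pd; apply: crd_eq0 => i.
  have := congr1 (fun p : {poly F} => p`_i) Pd; rewrite coef0 coef_sum.
  rewrite (bigD1 i) //= coefZ coefXn eqxx mulr1 big1 ?addr0 // => j ji.
  by rewrite coefZ coefXn eq_sym (inj_eq val_inj) (negPf ji) mulr0.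
have [|t] := @exists_nonroot F (\prod_(d <- D | d != 0) P d).
  by rewrite prodf_seq_neq0; apply/allP => d _; apply/implyP => /P0.
rewrite horner_prod prodf_seq_neq0 => /allP Dt.
exists (fun j => t ^+ j) => d /Dt; have [//|d0 /= Pd] := eqVneq d 0.
rewrite peval_lform => /eqP; rewrite -[_ == 0]negbK => /negP; case.
move: Pd; rewrite horner_sum; congr (_ != 0); apply: eq_bigr => j _.
by rewrite hornerZ hornerXn mulrC.
Qed.

(** * Fiber sums and the sign sum of a vector *)

Section SymmetricGroup3.
Variables (F : numFieldType) (V : fdrep 'S_3 F).
Implicit Types (g h : 'S_3) (i j k : 'I_3) (v w x : V).

Definition fiber_sum i v : V := \sum_(g : 'S_3 | g ord0 == i) rep_act g v.
Definition sign_sum v : V := \sum_(g : 'S_3) (-1) ^+ g *: rep_act g v.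

Lemma fiber_sumB i v w : fiber_sum i (v - w) = fiber_sum i v - fiber_sum i w.
Proof. by rewrite -sumrB; apply: eq_bigr => g _; rewrite linearB. Qed.

Lemma sign_sumB v w : sign_sum (v - w) = sign_sum v - sign_sum w.
Proof. by rewrite -sumrB; apply: eq_bigr => g _; rewrite linearB scalerBr. Qed.


(** A product of permutations applies its left factor first, so right multiplication by [h] carries
    the fiber over [i] to the fiber over [h i]. *)
Lemma fiber_sum_act h i v : fiber_sum i (rep_act h v) = fiber_sum (h i) v.
Proof.
rewrite /fiber_sum [RHS](reindex_inj (mulIg h)); apply: eq_big => g.
  by rewrite permM (inj_eq perm_inj).
by rewrite rep_actM.
Qed.

Lemma sign_sum_act h v : sign_sum (rep_act h v) = (-1) ^+ h *: sign_sum v.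
Proof.
rewrite /sign_sum [in RHS](reindex_inj (mulIg h)) scaler_sumr; apply: eq_bigr => g _.
by rewrite rep_actM scalerA odd_permM signr_addb mulrCA -expr2 sqrr_sign mulr1.
Qed.

Lemma ord3P i j k : i != j -> k != i -> k != j ->
  forall z : 'I_3, [\/ z = i, z = j | z = k].
Proof.
move=> ij ki kj z; case: (eqVneq z i) => [|zi]; first by constructor 1.
case: (eqVneq z j) => [|zj]; first by constructor 2.
constructor 3; apply/val_inj; move: ij ki kj zi zj; rewrite -!val_eqE /=.
by case: i j k z => [[|[|[|?]]] ?] [[|[|[|?]]] ?] [[|[|[|?]]] ?] [[|[|[|?]]] ?].
Qed.

Lemma ord3_third i j : exists k, (k != i) && (k != j).
Proof.
apply/existsP; apply: contraT; rewrite negb_exists => /forallP ijk.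
have : (#|[set i; j]| < #|{: 'I_3}|)%N by rewrite cards2 card_ord; case: (i != j).
rewrite ltnNge -cardsT subset_leq_card //; apply/subsetP => k _.
by have := ijk k; rewrite !inE negb_and !negbK.
Qed.

Lemma perm3_fix i j k g : i != j -> k != i -> k != j -> g k = k ->
  g = 1%g \/ g = tperm i j.
Proof.
move=> ij ki kj gk; have ijk := ord3P ij ki kj.
have gN z : z != k -> g z != k by rewrite -{2}gk (inj_eq perm_inj).
have gij z : z != k -> g z = i \/ g z = j.
  by move/gN; case: (ijk (g z)) => ->; rewrite ?eqxx; auto.
have gi := gij i; have gj := gij j; rewrite eq_sym in ki; rewrite eq_sym in kj.
have gNij : g i != g j by rewrite (inj_eq perm_inj).
case: (gi ki) (gj kj) gNij => {}gi [] {}gj; rewrite gi gj ?eqxx // => _.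
  by left; apply/permP => z; rewrite perm1; case: (ijk z) => ->.
right; apply/permP => z; case: (ijk z) => ->; rewrite ?tpermL ?tpermR //.
by rewrite tpermD.
Qed.

(** Moving a fiber sum by a transposition gives the sum of [g x] over the stabilizer of the third
    point [k]. That stabilizer consists of 1 and [tperm i j], so [x] and its image add up to 0. *)
Lemma tperm_act_opp x i j : (forall k, fiber_sum k x = 0) -> i != j ->
  rep_act (tperm i j) x = - x.
Proof.
move=> x0 ij; have [k /andP[ki kj]] := ord3_third i j.
have : \sum_(g : 'S_3 | g k == k) rep_act g x = 0.
  transitivity (rep_act (tperm ord0 k) (fiber_sum k x)); last first.
    by rewrite x0 linear0.
  rewrite linear_sum /= (reindex_inj (mulgI (tperm ord0 k))); apply: eq_big => g.
    by rewrite permM tpermR.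
  by rewrite rep_actM.
rewrite (bigD1 1%g) ?perm1 //= (bigD1 (tperm i j)) /=; last first.
  rewrite tpermD 1?eq_sym // eqxx /=; apply: contraNneq ij => /permP/(_ i).
  by rewrite tpermL perm1 => ->.
rewrite big1 => [|g /andP[/andP[/eqP gk]]]; last first.
  by case: (perm3_fix ij ki kj gk) => ->; rewrite eqxx.
by rewrite addr0 rep_act1 addrC => /eqP; rewrite addr_eq0 => /eqP.
Qed.

(** Every transposition negates [x], so each [g] acts on [x] by its sign and the sign sum equals 6
    [x]. *)
Lemma fiber_sign_sum_eq0 x :
  (forall i, fiber_sum i x = 0) -> sign_sum x = 0 -> x = 0.
Proof.
move=> x0; have xs g : rep_act g x = (-1) ^+ g *: x.
  have [ts -> ts2] := prod_tpermP g; rewrite odd_perm_prod //.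
  elim: ts ts2 => [|[i j] ts IH] /=; first by rewrite big_nil rep_act1 scale1r.
  case/andP=> ij /IH; rewrite big_cons rep_actM => ->.
  by rewrite linearZ /= tperm_act_opp // signrN scalerN scaleNr.
rewrite /sign_sum; under eq_bigr => g _ do rewrite xs scalerA -expr2 sqrr_sign scale1r.
rewrite sumr_const card_Sn => /eqP; rewrite -scaler_nat scaler_eq0 pnatr_eq0.
by move/eqP.
Qed.

Lemma fiber_sign_sum_inj v w : (forall i, fiber_sum i v = fiber_sum i w) ->
  sign_sum v = sign_sum w -> v = w.
Proof.
move=> vw svw; apply/eqP; rewrite -subr_eq0; apply/eqP/fiber_sign_sum_eq0 => [i|].
  by rewrite fiber_sumB vw subrr.
by rewrite sign_sumB svw subrr.
Qed.

(** * Invariants built from one linear form *)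

Section Polynomials.
Variable c : 'I_(\dim {:V}) -> F.

Definition fiber_poly i : coord_ring V :=
  \sum_(g : 'S_3 | g ord0 == i) poly_act g^-1%g (lform c).
Definition sign_poly : coord_ring V :=
  \sum_(g : 'S_3) (-1) ^+ g *: poly_act g^-1%g (lform c).

Lemma peval_fiber_poly i v : peval (fiber_poly i) v = peval (lform c) (fiber_sum i v).
Proof.
rewrite /fiber_sum linear_sum /= /fiber_poly {1}/peval raddf_sum.
by apply: eq_bigr => g _; rewrite -peval_actV.
Qed.

Lemma peval_sign_poly v : peval sign_poly v = peval (lform c) (sign_sum v).
Proof.
rewrite /sign_sum linear_sum /= /sign_poly {1}/peval raddf_sum.
by apply: eq_bigr => g _; rewrite /= !linearZ /= -peval_actV.
Qed.

Lemma fiber_poly_act h i : poly_act h (fiber_poly (h i)) = fiber_poly i.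
Proof.
rewrite /fiber_poly raddf_sum /= (reindex_inj (mulIg h)); apply: eq_big => g.
  by rewrite permM (inj_eq perm_inj).
by rewrite poly_actM invMg mulKVg.
Qed.

Lemma sign_poly_act h : poly_act h sign_poly = (-1) ^+ h *: sign_poly.
Proof.
rewrite /sign_poly raddf_sum /= (reindex_inj (mulIg h)) scaler_sumr.
apply: eq_bigr => g _; rewrite /= linearZ /= poly_actM invMg mulKVg scalerA.
by rewrite odd_permM signr_addb mulrC.
Qed.

Lemma msize_fiber_poly i : (msize (fiber_poly i) <= 2)%N.
Proof.
apply: msize_sum_leq => g _.
by rewrite (leq_trans (msize_poly_act _ _)) ?msize_lform.
Qed.

Lemma msize_sign_poly : (msize sign_poly <= 2)%N.
Proof.
apply: msize_sum_leq => g _; rewrite (leq_trans (msizeZ_le _ _)) //.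
by rewrite (leq_trans (msize_poly_act _ _)) ?msize_lform.
Qed.

(** With [t] varying, these invariants replace the elementary symmetric functions of the three fiber
    polynomials. *)
Definition fiber_charpoly (t : F) : coord_ring V := \prod_i (fiber_poly i - t%:MP).

Lemma fiber_charpoly_invariant t : poly_invariant (fiber_charpoly t).
Proof.
move=> g; rewrite /fiber_charpoly rmorph_prod (reindex_inj (@perm_inj _ g)).
apply: eq_bigr => i _; rewrite /= rmorphB /= fiber_poly_act.
by rewrite /poly_act comp_mpolyC.
Qed.

Lemma msize_fiber_charpoly t : (msize (fiber_charpoly t) <= 4)%N.
Proof.
apply: leq_trans (msize_prod_leq (d := fun=> 1%N) _ _) _ => [i _|].
  rewrite msizeB_leq ?msize_fiber_poly //.
  by rewrite msizeC; case: eqP.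
by rewrite sum1_card card_ord.
Qed.

Lemma peval_fiber_charpoly t v :
  peval (fiber_charpoly t) v = \prod_i (peval (lform c) (fiber_sum i v) - t).
Proof.
rewrite {1}/peval rmorph_prod; apply: eq_bigr => i _.
by rewrite /= rmorphB /= mevalC -peval_fiber_poly.
Qed.

Lemma sign_poly_sqr_invariant : poly_invariant (sign_poly ^+ 2).
Proof.
by move=> g; rewrite rmorphXn /= sign_poly_act exprZn sqrr_sign scale1r.
Qed.

Lemma msize_sign_poly_sqr : (msize (sign_poly ^+ 2) <= 3)%N.
Proof. exact: msizeX_leq msize_sign_poly. Qed.

(** The product of differences is written as a determinant, so that its sign change under [g] comes
    from a permutation of columns. *)
Definition fiber_vandermonde : coord_ring V :=
  \det (Vandermonde 3 (\row_i fiber_poly i)).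

Lemma fiber_vandermonde_act g :
  poly_act g fiber_vandermonde = (-1) ^+ g *: fiber_vandermonde.
Proof.
rewrite /fiber_vandermonde -det_map_mx.
(* Column [j] holds the powers of [fiber_poly j], which [g] sends to [fiber_poly (g^-1 j)]. *)
have -> : map_mx (poly_act g) (Vandermonde 3 (\row_i fiber_poly i)) =
          col_perm g^-1 (Vandermonde 3 (\row_i fiber_poly i)).
  apply/matrixP=> i j; rewrite !mxE rmorphXn /=.
  by rewrite -{1}[j](permKV g) fiber_poly_act.
rewrite col_permE det_mulmx det_perm invgK mulrC -[RHS]mul_mpolyC.
by rewrite rmorphXn rmorphN rmorph1.
Qed.

Lemma sign_vandermonde_invariant :
  poly_invariant (sign_poly * fiber_vandermonde).
Proof.
move=> g; rewrite rmorphM /= sign_poly_act fiber_vandermonde_act.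
by rewrite -scalerAl -scalerAr scalerA -expr2 sqrr_sign scale1r.
Qed.

Lemma msize_sign_vandermonde : (msize (sign_poly * fiber_vandermonde) <= 5)%N.
Proof.
(* The sign form has degree 1. Row [i] of the matrix consists of [i]-th powers, so each Leibniz term
   has degree at most 0 + 1 + 2 = 3. *)
apply: (@msizeM_leq _ _ _ _ 1 3); first exact: msize_sign_poly.
apply: msize_sum_leq => s _.
have -> : (-1) ^+ s = ((-1) ^+ s)%:MP :> coord_ring V.
  by rewrite rmorphXn rmorphN rmorph1.
rewrite mul_mpolyC (leq_trans (msizeZ_le _ _)) //.
apply: leq_trans (msize_prod_leq (d := val) _ _) _ => [i _|]; last first.
  by rewrite !big_ord_recl big_ord0.
rewrite !mxE (leq_trans (msizeX_leq (a := 1) _ _)) ?mul1n //.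
exact: msize_fiber_poly.
Qed.

Lemma peval_fiber_vandermonde v : peval fiber_vandermonde v =
  \prod_(i < 3) \prod_(j < 3 | (i < j)%N)
    (peval (lform c) (fiber_sum j v) - peval (lform c) (fiber_sum i v)).
Proof.
rewrite /fiber_vandermonde det_Vandermonde {1}/peval rmorph_prod.
apply: eq_bigr => i _; rewrite /= rmorph_prod; apply: eq_bigr => j _.
by rewrite /= !mxE rmorphB -!peval_fiber_poly.
Qed.

End Polynomials.

(** * Invariants of degree at most 4 separate the orbits *)

Definition invariants_agree d v w := forall f : coord_ring V,
  poly_invariant f -> (msize f <= d.+1)%N -> peval f v = peval f w.

Lemma agree_fiber_sum v w : invariants_agree 3 v w ->
  exists g, forall i, fiber_sum i w = fiber_sum i (rep_act g v).
Proof.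
(* The form detects every nonzero difference of a fiber sum of [w] and one of [v], so equal values
   will mean equal vectors. *)
move=> vw; have [c c0] := exists_lform_neq0
  [seq fiber_sum p.1 w - fiber_sum p.2 v | p : 'I_3 * 'I_3].
pose b u i := peval (lform c) (fiber_sum i u).
have bE : \prod_i ('X - (b v i)%:P) = \prod_i ('X - (b w i)%:P).
  apply/eqP; rewrite -subr_eq0; apply: contraT => /exists_nonroot[t].
  have := vw _ (@fiber_charpoly_invariant c t) (msize_fiber_charpoly c t).
  rewrite !peval_fiber_charpoly hornerD hornerN !horner_prod => bvw.
  suff -> : \prod_i ('X - (b v i)%:P).[t] = \prod_i ('X - (b w i)%:P).[t].
    by rewrite subrr eqxx.
  have bN u : \prod_i ('X - (b u i)%:P).[t] = - \prod_i (b u i - t).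
    by rewrite !big_ord_recl !big_ord0 !hornerXsubC; ring.
  by rewrite !bN bvw.
(* Equal split polynomials have the same roots with multiplicity; the permutation matching them is
   the required [g]. *)
have : perm_eq [tuple b w i | i < 3] [tuple b v i | i < 3].
  apply: prod_XsubC_eq; rewrite !big_tuple.
  under eq_bigr do rewrite tnth_mktuple.
  by under [RHS]eq_bigr do rewrite tnth_mktuple.
case/tuple_permP => g bg; exists g => i; rewrite fiber_sum_act.
apply/eqP; rewrite -subr_eq0; apply/eqP/c0.
  by apply/imageP; exists (i, g i).
apply/eqP; rewrite linearB subr_eq0 /=.
by have := congr1 (fun t => tnth t i) (val_inj bg); rewrite !tnth_mktuple => /eqP.
Qed.

Lemma agree_sign_sum v w : invariants_agree 2 v w ->
  sign_sum w = sign_sum v \/ sign_sum w = - sign_sum v.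
Proof.
(* Both vectors are listed because either factor of the difference of squares may vanish. *)
move=> vw; have [c c0] := exists_lform_neq0
  [:: sign_sum w - sign_sum v; sign_sum w + sign_sum v].
have := vw _ (@sign_poly_sqr_invariant c) (msize_sign_poly_sqr c).
rewrite !pevalM !peval_sign_poly -!expr2 => /esym/eqP.
rewrite eqf_sqr -subr_eq0 -linearB -addr_eq0 -linearD => /orP[] /eqP/c0 E.
  by left; apply/eqP; rewrite -subr_eq0 E ?inE ?eqxx.
by right; apply/eqP; rewrite -addr_eq0 E ?inE ?eqxx ?orbT.
Qed.

(** The quartic invariant takes opposite values at [v] and [w], hence vanishes at [v]. The form does
    not kill [sign_sum v], so some difference of fiber sums is 0. *)
Lemma agree_fiber_sum_eq v w : invariants_agree 4 v w ->
  (forall i, fiber_sum i w = fiber_sum i v) -> sign_sum w = - sign_sum v ->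
  sign_sum v != 0 -> exists i j, i != j /\ fiber_sum i v = fiber_sum j v.
Proof.
move=> vw fvw svw sv0; have [c c0] := exists_lform_neq0
  (sign_sum v :: [seq fiber_sum p.2 v - fiber_sum p.1 v | p : 'I_3 * 'I_3]).
have := vw _ (@sign_vandermonde_invariant c) (msize_sign_vandermonde c).
rewrite !pevalM !peval_sign_poly !peval_fiber_vandermonde.
under [in RHS]eq_bigr => i _ do under eq_bigr => j _ do rewrite !fvw.
rewrite svw linearN mulNr => /eqP; rewrite -addr_eq0 -mulr2n mulrn_eq0 /=.
rewrite mulf_eq0 => /orP[/eqP/c0|].
  by rewrite inE eqxx => /(_ isT)/eqP; rewrite (negPf sv0).
case/prodf_eq0 => i _ /prodf_eq0[j ij]; rewrite -linearB => /eqP/c0 E.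
exists i, j; rewrite -(inj_eq val_inj) neq_ltn ij; split=> //; apply/esym/eqP.
rewrite -subr_eq0 E // inE; apply/orP; right.
by apply/imageP; exists (i, j).
Qed.

Lemma agree_orbit v w : invariants_agree 4 v w -> w \in rep_orbit v.
Proof.
move=> vw.
have leq_agree d v' : (d <= 4)%N -> invariants_agree 4 v' w -> invariants_agree d v' w.
  by move=> d4 E f fG fd; apply: E => //; apply: leq_trans fd _.
have [g fvw] := agree_fiber_sum (leq_agree 3%N _ isT vw).
(* Replacing [v] by its translate under [g] makes all fiber sums of [v] and [w] equal. *)
rewrite -(rep_orbit_act g).
have {vw}: invariants_agree 4 (rep_act g v) w.
  by move=> f fG fd; rewrite poly_invariant_peval // vw.
move: (rep_act g v) fvw => {g}v fvw vw; apply/rep_orbitP.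
have [sw|sw] := agree_sign_sum (leq_agree 2%N _ isT vw).
  by exists 1%g; rewrite rep_act1; apply: fiber_sign_sum_inj.
have [sv|sv] := eqVneq (sign_sum v) 0.
  by exists 1%g; rewrite rep_act1; apply: fiber_sign_sum_inj => //; rewrite sw sv oppr0.
have [i [j [ij fij]]] := agree_fiber_sum_eq vw fvw sw sv.
exists (tperm i j); apply: fiber_sign_sum_inj => [k|].
  by rewrite fvw fiber_sum_act; case: tpermP => // ->.
by rewrite sw sign_sum_act odd_tperm ij scaleN1r.
Qed.

Lemma separates_orbits4 : separates_orbits V 4.
Proof.
move=> v w vw; apply: NNPP => noF; apply: vw => u.
have /rep_orbitP[g ->] : w \in rep_orbit v.
  apply: agree_orbit => f fG fd; apply: NNPP => fvw; apply: noF.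
  by exists f.
by rewrite rep_orbit_act.
Qed.

End SymmetricGroup3.

(** Listing the variables of a monomial with multiplicity turns a bound on its degree into a bound
    on the length of a list. *)
Lemma prodX_seq (n : nat) (m : 'X_{1..n}) : exists2 s : seq 'I_n,
  size s = mdeg m &
  forall (F : comNzRingType) (x : 'I_n -> F),
    \prod_i x i ^+ m i = \prod_(i <- s) x i.
Proof.
exists (flatten [seq nseq (m i) i | i <- enum 'I_n]).
  rewrite size_flatten /shape -map_comp sumnE big_map big_enum mdegE.
  by apply: eq_bigr => i _; rewrite /= size_nseq.
move=> F x; rewrite big_flatten big_map big_enum; apply: eq_bigr => i _.
by rewrite big_nseq iter_mulr_1.
Qed.

(** * Two orbits in the regular representation that degree 3 does not separate *)

Section RegularRepresentation.
Variable F : realFieldType.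
Let V := regular_rep 'S_3 F.
Implicit Types (g h t : 'S_3) (i j k : 'I_3) (e : F).

Lemma alternating_sum_eq0 (y : 'S_3 -> F) t :
  odd_perm t -> (forall g, y (t * g)%g = y g) ->
  \sum_(g : 'S_3) (-1) ^+ g * y g = 0.
Proof.
move=> t1 yt; set S := \sum_g _; suff: S = - S by lra.
rewrite {1}/S (reindex_inj (mulgI t)) -sumrN; apply: eq_bigr => g _.
by rewrite yt odd_permM t1 signrN mulNr.
Qed.

(* The product is unchanged when a transposition that preserves {i, j} is
   applied first. *)
Lemma alternating_sum2_eq0 (phi : 'I_3 -> F) i j :
  \sum_(g : 'S_3) (-1) ^+ g * (phi (g i) * phi (g j)) = 0.
Proof.
have [<-|ij] := eqVneq i j; last first.
  apply: (alternating_sum_eq0 (t := tperm i j)) => [|g]; first by rewrite odd_tperm.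
  by rewrite !permM tpermL tpermR mulrC.
have [k /andP[ki _]] := ord3_third i i; have [l /andP[li lk]] := ord3_third i k.
apply: (alternating_sum_eq0 (t := tperm k l)) => [|g].
  by rewrite odd_tperm eq_sym.
by rewrite !permM tpermD.
Qed.

Definition sign_fun : V := [ffun h : 'S_3 => (-1) ^+ h].
Definition coset_fun i : V := [ffun h : 'S_3 => ((h^-1)%g ord0 == i)%:R].
Definition reg_pt e : V :=
  [ffun h : 'S_3 => e * (-1) ^+ h + (nat_of_ord ((h^-1)%g ord0))%:R].

(** Translation by [g] multiplies the sign component by the sign of [g] and permutes the
    coefficients 0, 1, 2 along the coset indicators. *)
Lemma rep_act_reg_pt g e : rep_act g (reg_pt e) =
  (e * (-1) ^+ g) *: sign_fun + \sum_i (nat_of_ord (g i))%:R *: coset_fun i.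
Proof.
apply/ffunP => h; rewrite !ffunE sum_ffunE (bigD1 ((h^-1)%g ord0)) //= big1 => [|i].
  rewrite !ffunE eqxx invMg invgK permM odd_permM odd_permV signr_addb.
  by rewrite /GRing.scale /= addr0 mulr1 mulrA.
by rewrite !ffunE eq_sym => /negPf ->; rewrite scaler0.
Qed.

Let x (a : 'I_(\dim {:V})) : F := crd a sign_fun.
Let y (a : 'I_(\dim {:V})) g : F :=
  \sum_i (nat_of_ord (g i))%:R * crd a (coset_fun i).

Lemma crd_reg_pt a g e :
  crd a (rep_act g (reg_pt e)) = e * (-1) ^+ g * x a + y a g.
Proof.
rewrite rep_act_reg_pt /crd linearD linearZ linear_sum; congr (_ + _).
by apply: eq_bigr => i _; rewrite linearZ.
Qed.

Lemma alternating_sum_y0 (c : F) : \sum_(g : 'S_3) c * (-1) ^+ g = 0.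
Proof.
rewrite -mulr_sumr; have := @alternating_sum2_eq0 (fun=> 1) ord0 ord0.
by under eq_bigr do rewrite !mulr1; move->; rewrite mulr0.
Qed.

Lemma alternating_sum_y2 a b : \sum_(g : 'S_3) (-1) ^+ g * (y a g * y b g) = 0.
Proof.
under eq_bigr => g _ do rewrite mulr_suml mulr_sumr.
rewrite exchange_big big1 //= => i _.
under eq_bigr => g _ do rewrite mulr_sumr mulr_sumr.
rewrite exchange_big big1 //= => j _.
move: (crd a _) (crd b _) => p q.
have E := alternating_sum2_eq0 (fun k => (nat_of_ord k)%:R) i j.
transitivity (p * q * \sum_(g : 'S_3) (-1) ^+ g *
    ((nat_of_ord (g i))%:R * (nat_of_ord (g j))%:R)); last by rewrite E mulr0.
rewrite mulr_sumr; apply: eq_bigr => g _.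
by rewrite [RHS]mulrCA (mulrACA _ p) (mulrC (p * q)).
Qed.

Lemma alternating_sum_y1 a : \sum_(g : 'S_3) (-1) ^+ g * y a g = 0.
Proof.
under eq_bigr => g _ do rewrite mulr_sumr.
rewrite exchange_big big1 //= => i _.
under eq_bigr => g _ do rewrite mulrA; rewrite -mulr_suml.
(* The transposition of the two points other than [i] leaves [g i] unchanged. *)
have [k /andP[ki _]] := ord3_third i i; have [l /andP[li lk]] := ord3_third i k.
rewrite (alternating_sum_eq0 (t := tperm k l)) ?mul0r // => [|g].
  by rewrite odd_tperm eq_sym.
by rewrite permM tpermD.
Qed.

(** In the difference only terms with an odd number of sign factors survive. With at most three
    factors, at most two factors [y] accompany them, and those alternating sums vanish. *)
Lemma orbit_moment_eq (s : seq 'I_(\dim {:V})) : (size s <= 3)%N ->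
  \sum_(g : 'S_3) \prod_(a <- s) crd a (rep_act g (reg_pt 1)) =
  \sum_(g : 'S_3) \prod_(a <- s) crd a (rep_act g (reg_pt (-1))).
Proof.
move=> s3; apply/eqP; rewrite -subr_eq0 -sumrB; apply/eqP.
have y1 c a : \sum_(g : 'S_3) c * ((-1) ^+ g * y a g) = 0.
  by rewrite -mulr_sumr alternating_sum_y1 mulr0.
have y2 c a b : \sum_(g : 'S_3) c * ((-1) ^+ g * (y a g * y b g)) = 0.
  by rewrite -mulr_sumr alternating_sum_y2 mulr0.
case: s s3 => [|a [|b [|c []]]] // _.
- by rewrite big1 // => g _; rewrite !big_nil subrr.
- apply: etrans (alternating_sum_y0 (2 * x a)); apply: eq_bigr => g _.
  rewrite !big_cons !big_nil !crd_reg_pt.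
  by move: (x _) (y _ _) ((-1) ^+ g) => *; ring.
- transitivity (\sum_(g : 'S_3) (2 * x a * ((-1) ^+ g * y b g) +
    2 * x b * ((-1) ^+ g * y a g))).
    apply: eq_bigr => g _; rewrite !big_cons !big_nil !crd_reg_pt.
    by move: (x a) (x b) (y a g) (y b g) ((-1) ^+ g) => *; ring.
  by rewrite big_split /= !y1 addr0.
- transitivity (\sum_(g : 'S_3) (2 * x a * ((-1) ^+ g * (y b g * y c g)) +
    2 * x b * ((-1) ^+ g * (y a g * y c g)) +
    2 * x c * ((-1) ^+ g * (y a g * y b g)) + 2 * x a * x b * x c * (-1) ^+ g)).
    apply: eq_bigr => g _; rewrite !big_cons !big_nil !crd_reg_pt.
    move: (x a) (x b) (x c) (y a g) (y b g) (y c g) => *.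
    (* The cube of the sign is the sign itself, checked for each parity. *)
    by case: (odd_perm g); ring.
  by rewrite !big_split /= !y2 alternating_sum_y0 !addr0.
Qed.

Lemma orbit_sum_mpoly (f : coord_ring V) (v : V) :
  \sum_(g : 'S_3) peval f (rep_act g v) =
  \sum_(m <- msupp f) f@_m * \sum_(g : 'S_3) \prod_i crd i (rep_act g v) ^+ m i.
Proof.
under eq_bigr => g _ do rewrite /peval mevalE.
by rewrite exchange_big; apply: eq_bigr => m _; rewrite mulr_sumr.
Qed.

(** An invariant is its own average over the group, so six times its value is a combination of orbit
    sums of monomials of degree at most 3. *)
Lemma reg_pt_agree : invariants_agree 3 (reg_pt 1) (reg_pt (-1)).
Proof.
move=> f fG f3.
have avg v : 6%:R * peval f v = \sum_(g : 'S_3) peval f (rep_act g v).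
  rewrite (eq_bigr (fun=> peval f v)) => [|g _]; last exact: poly_invariant_peval.
  by rewrite sumr_const card_Sn mulr_natl.
have n6 : 6%:R != 0 :> F by rewrite pnatr_eq0.
apply: (mulfI n6); rewrite !avg !orbit_sum_mpoly.
rewrite !big_seq; apply: eq_bigr => m mf; congr (_ * _).
have [s sm sE] := prodX_seq m.
under eq_bigr do rewrite sE; under [RHS]eq_bigr do rewrite sE.
by rewrite orbit_moment_eq // sm -ltnS (leq_trans (msize_mdeg_lt mf)).
Qed.

Lemma reg_pt_orbit : reg_pt (-1) \notin rep_orbit (reg_pt 1).
Proof.
apply/rep_orbitP => -[g /ffunP E].
have gE h : - (-1) ^+ h + (nat_of_ord ((h^-1)%g ord0))%:R =
    (-1) ^+ g * (-1) ^+ h + (nat_of_ord (g ((h^-1)%g ord0)))%:R :> F.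
  have := E h; rewrite !ffunE invMg invgK permM odd_permM odd_permV signr_addb.
  by rewrite mul1r mulN1r.
have g1 : g = 1%g.
  apply/permP => i; rewrite perm1; apply/val_inj/eqP; rewrite -(eqr_nat F) /=.
  have [k /andP[k0 _]] := ord3_third ord0 ord0.
  have [l /andP[l0 lk]] := ord3_third ord0 k.
  (* The inverses of both permutations send 0 to [i], and their signs are opposite. Adding the two
     equations cancels the signs and leaves [g i = i]. *)
  have := gE (tperm ord0 i); have := gE (tperm ord0 i * tperm k l)%g.
  rewrite invMg !tpermV permM (tpermD k0 l0) tpermL odd_permM !odd_tperm signr_addb.
  rewrite (eq_sym k l) lk expr1 => E1 E2; apply/eqP; move: E1 E2.
  move: ((-1) ^+ (ord0 != i)) ((-1) ^+ g) _%:R _%:R => s t p q E1 E2.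
  lra.
have := gE 1%g; rewrite g1 invg1 !perm1 odd_perm1 /= expr0; move: _%:R => p; lra.
Qed.

End RegularRepresentation.

(** * Least separating degrees and the exact value *)

Lemma is_beta_sep_exists (gT : finGroupType) (F : fieldType) (V : fdrep gT F) d :
  (0 < d)%N -> separates_orbits V d -> exists2 e, is_beta_sep V e & (e <= d)%N.
Proof.
elim/ltn_ind: d => d IHd d0 Vd.
have [[e [e0 ed Ve]]|noE] :=
    classic (exists e, [/\ (0 < e)%N, (e < d)%N & separates_orbits V e]).
  by have [b Vb be] := IHd e ed e0 Ve; exists b => //; rewrite (leq_trans be) // ltnW.
exists d => //; split=> // e e0 Ve; rewrite leqNgt; apply/negP => ed.
by apply: noE; exists e.
Qed.

Theorem proposition4p5 :
  (exists v w : regular_rep 'S_3 rat,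
      ~ (rep_orbit v =i rep_orbit w) /\
      forall f : coord_ring (regular_rep 'S_3 rat),
        poly_invariant f -> (msize f <= 4)%N -> peval f v = peval f w) /\
  is_beta_sep_field 'S_3 rat 4.
Proof.
have not_orbit : ~ (rep_orbit (@reg_pt rat 1) =i rep_orbit (@reg_pt rat (-1))).
  move=> E; have := reg_pt_orbit rat; rewrite E => /rep_orbitP; apply.
  by exists 1%g; rewrite rep_act1.
split.
  exists (@reg_pt rat 1), (@reg_pt rat (-1)).
  by split=> //; apply: reg_pt_agree.
split=> [|V]; last exact/is_beta_sep_exists/(@separates_orbits4 rat V).
exists (regular_rep 'S_3 rat); split=> //; first exact: (@separates_orbits4 rat).
(* If [e < 4], a separating [f] has [msize f <= 4], that is, degree at most 3. *)
move=> e _ sep; rewrite leqNgt; apply/negP => e4.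
have [f [fG fe]] := sep _ _ not_orbit; case.
by apply: reg_pt_agree => //; apply: leq_trans fe e4.
Qed.
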